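(* The map $T$ has four potential fixed points, $$P_1=\left(\frac{a-c+1}{a},\frac1a\right),\quad P_2=\left(\frac{a-c+1}{a+2c-2},\frac{3}{a+2c-2}\right),\quad P_3=\left(\frac{a+c+1}{a-2c-2},\frac{3}{a-2c-2}\right),\quad P_4=\left(\frac{a+c+1}{a},\frac1a\right),$$ corresponding to the fixed points of the linear maps $T_1,T_2,T_3,T_4$ respectively.
   Context: For real parameters $a,c$, $T:\mathbb{R}^2\to\mathbb{R}^2$ is the continuous piecewise linear map $T(x,y)=(|x|+ay-1,\;x+c|y|-1)$. The plane is divided into the closed quadrants $Q_1=\{x\ge 0,y\ge 0\}$, $Q_2=\{x\le 0,y\ge 0\}$, $Q_3=\{x\le 0,y\le 0\}$, $Q_4=\{x\ge 0,y\le 0\}$. On $Q_i$ the map $T$ is given by the map $T_i$ (affine, called linear here), where $T_1(x,y)=(x+ay-1,x+cy-1)$, $T_2(x,y)=(-x+ay-1,x+cy-1)$, $T_3(x,y)=(-x+ay-1,x-cy-1)$, $T_4(x,y)=(x+ay-1,x-cy-1)$. The point $P_i$ is called a real fixed point if $P_i\in Q_i$ and a virtual fixed point if $P_i\notin Q_i$; $T$ can only have a fixed point at $P_i$ if $P_i$ is real, which is why the $P_i$ are called potential fixed points. *)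

(* Defs.v *)
From Stdlib Require Import Reals Lra.
Open Scope R_scope.

Definition T (a c : R) (p : R * R) : R * R :=
  let (x, y) := p in (Rabs x + a * y - 1, x + c * Rabs y - 1).

Inductive quadrant : Set := I | II | III | IV.

Definition Q (i : quadrant) (p : R * R) : Prop :=
  let (x, y) := p in
  match i with
  | I   => x >= 0 /\ y >= 0
  | II  => x <= 0 /\ y >= 0
  | III => x <= 0 /\ y <= 0
  | IV  => x >= 0 /\ y <= 0
  end.

Definition T_ (a c : R) (i : quadrant) (p : R * R) : R * R :=
  let (x, y) := p in
  match i with
  | I   => (  x + a * y - 1, x + c * y - 1)
  | II  => (- x + a * y - 1, x + c * y - 1)
  | III => (- x + a * y - 1, x - c * y - 1)
  | IV  => (  x + a * y - 1, x - c * y - 1)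
  end.

Lemma T_on_Q (a c : R) (i : quadrant) (p : R * R) :
  Q i p -> T a c p = T_ a c i p.
Proof.
  destruct p as [x y]; destruct i; intros [Hx Hy]; cbn;
    f_equal; unfold Rabs; repeat destruct Rcase_abs; try lra;
    replace y with 0 by lra; lra.
Qed.

Definition fixed_point (f : R * R -> R * R) (p : R * R) : Prop := f p = p.

(* Up to sign, [den a c i] is the determinant of the linear part of [T_ a c i]
   minus the identity. *)
Definition den (a c : R) (i : quadrant) : R :=
  match i with
  | I   => a
  | II  => a + 2 * c - 2
  | III => a - 2 * c - 2
  | IV  => a
  end.

(* Meaningful only if [den a c i <> 0]: division by zero is total in [R]. *)
Definition P (a c : R) (i : quadrant) : R * R :=
  match i with
  | I   => ((a - c + 1) / a, 1 / a)
  | II  => ((a - c + 1) / (a + 2 * c - 2), 3 / (a + 2 * c - 2))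
  | III => ((a + c + 1) / (a - 2 * c - 2), 3 / (a - 2 * c - 2))
  | IV  => ((a + c + 1) / a, 1 / a)
  end.

Definition real_fixed_point (a c : R) (i : quadrant) : Prop := Q i (P a c i).

(* Main.v *)
Require Import Defs.
From Stdlib Require Import Reals Lra.
Open Scope R_scope.

(** The fixed-point equation of each affine branch is a 2 by 2 linear system.
    Eliminating [x] from it leaves a single equation [den a c i * y = k] whose
    right-hand side [k] is 1 or 3, hence never zero.  This settles both the
    regular and the degenerate case: if [den a c i <> 0] the system has the
    unique solution [P a c i], and if [den a c i = 0] it has no solution at
    all ([fixed_point_branch_den]).  A fixed point of a branch is therefore
    always the point [P a c i], with a nonzero denominator.  Since the
    quadrants cover the plane and [T] agrees on [Q i] with the branch
    [T_ a c i], the fixed points of [T] are exactly those [P a c i] that lie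
    in their own quadrant. *)

(** A singular branch would turn the equation in [y] alone into [0 = 1]
    (quadrants I and IV) or [0 = 3] (quadrants II and III). *)
Lemma fixed_point_branch_den (a c : R) (i : quadrant) (p : R * R) :
  fixed_point (T_ a c i) p -> den a c i <> 0.
Proof.
  destruct p as [x y]; unfold fixed_point; intros H Hd.
  assert (Hy : den a c i * y = 0) by (rewrite Hd; ring).
  destruct i; cbn in H, Hy; injection H as H1 H2; lra.
Qed.

Lemma fixed_point_branch_iff (a c : R) (i : quadrant) (p : R * R) :
  den a c i <> 0 -> fixed_point (T_ a c i) p <-> p = P a c i.
Proof.
  destruct p as [x y]; unfold fixed_point; intros Hd; split; intros H.
  - (* Clearing denominators turns the goal for [y] into the eliminated
       equation.  The goal for [x] keeps products of parameters with
       unknowns; writing [x] in terms of [y] gathers them into multiples of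
       [den a c i * y], whose value is known. *)
    destruct i; cbn in H, Hd |- *; injection H as H1 H2; f_equal;
      refine (Rmult_eq_reg_r _ _ _ _ Hd);
      unfold Rdiv; rewrite Rmult_assoc, Rinv_l, Rmult_1_r by exact Hd;
      try lra.
    + replace x with (1 + y - c * y) by lra.
      replace ((1 + y - c * y) * a) with (a + (1 - c) * (a * y)) by ring.
      replace (a * y) with 1 by lra; ring.
    + replace x with ((a * y - 1) / 2) by lra.
      assert (Hy : (a + 2 * c - 2) * y = 3) by lra.
      replace ((a * y - 1) / 2 * (a + 2 * c - 2))
        with ((a * ((a + 2 * c - 2) * y) - (a + 2 * c - 2)) / 2) by field.
      rewrite Hy; field.
    + replace x with ((a * y - 1) / 2) by lra.
      assert (Hy : (a - 2 * c - 2) * y = 3) by lra.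
      replace ((a * y - 1) / 2 * (a - 2 * c - 2))
        with ((a * ((a - 2 * c - 2) * y) - (a - 2 * c - 2)) / 2) by field.
      rewrite Hy; field.
    + replace x with (1 + y + c * y) by lra.
      replace ((1 + y + c * y) * a) with (a + (1 + c) * (a * y)) by ring.
      replace (a * y) with 1 by lra; ring.
  - rewrite H; destruct i; cbn in Hd |- *; f_equal; field; exact Hd.
Qed.

Lemma quadrants_cover (p : R * R) : exists i : quadrant, Q i p.
Proof.
  destruct p as [x y].
  destruct (Rle_dec 0 x), (Rle_dec 0 y);
    [exists I | exists IV | exists II | exists III]; cbn; lra.
Qed.

Theorem proposition3p2 (a c : R) :
  (forall i : quadrant, den a c i <> 0 ->
     forall p : R * R, fixed_point (T_ a c i) p <-> p = P a c i) /\
  (forall p : R * R, fixed_point (T a c) p <->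
     exists i : quadrant, den a c i <> 0 /\ real_fixed_point a c i /\ p = P a c i).
Proof.
  split.
  - intros i Hd p; exact (fixed_point_branch_iff a c i p Hd).
  - intros p; split.
    + intros H; destruct (quadrants_cover p) as [i Hi].
      assert (Hfix : fixed_point (T_ a c i) p).
      { unfold fixed_point; rewrite <- (T_on_Q a c i p Hi); exact H. }
      assert (Hd := fixed_point_branch_den a c i p Hfix).
      assert (Hp := proj1 (fixed_point_branch_iff a c i p Hd) Hfix).
      exists i; repeat split; [exact Hd | | exact Hp].
      unfold real_fixed_point; rewrite <- Hp; exact Hi.
    + intros [i [Hd [Hreal Hp]]].
      assert (Hi : Q i p) by (rewrite Hp; exact Hreal).
      unfold fixed_point; rewrite (T_on_Q a c i p Hi).
      exact (proj2 (fixed_point_branch_iff a c i p Hd) Hp).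
Qed.
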